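(* Let $n\ge1$, $\lambda>0$, let $\Delta^{n-1}=\{x\in\mathbb{R}^n : \sum_{i=1}^n x_i=1,\ x_i\ge0\}$, and let $\sigma:\mathbb{R}^n\to\Delta^{n-1}$, $\sigma_i(z)=\frac{\exp(\lambda z_i)}{\sum_{j=1}^n\exp(\lambda z_j)}$, be the softmax function. Let $\mathcal{G}$ be a single-player game with action set $\{1,\dots,n\}$ and continuous payoff vector $U:\Delta^{n-1}\to\mathbb{R}^n$. Suppose that the player's learning scheme is the exponentially-discounted reinforcement learning scheme $$\dot z = u - z,\qquad u=U(x),\qquad x=\sigma(z),$$ that is, the score $z(t)\in\mathbb{R}^n$, $t\ge0$, is a solution of $\dot z=(U\circ\sigma)(z)-z$ and the induced strategy is $x(t)=\sigma(z(t))$. Assume that the map $U\circ\sigma:\mathbb{R}^n\to\mathbb{R}^n$ has a finite number of isolated fixed points $\overline z^\star$, and that $U$ is anti-monotone, that is, $$(x-x')^\top(U(x)-U(x'))\le0\quad\text{for all }x,x'\in\Delta^{n-1}.$$ Then the player's score $z(t)$ converges, as $t\to\infty$, to a rest point $\overline z^\star$ (a fixed point of $U\circ\sigma$). Moreover, $x(t)=\sigma(z(t))$ converges to a logit equilibrium $\overline x^\star=\sigma(\overline z^\star)$ of $\mathcal{G}$.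
   Context: In the game $\mathcal{G}$, a mixed strategy is a point $x\in\Delta^{n-1}$; $U(x)=(U_1(x),\dots,U_n(x))^\top$ is the payoff vector at $x$, where $U_i(x)$ is the payoff to the $i$-th pure strategy, and the expected payoff of $x$ is $x^\top U(x)$. The rest points of $\dot z=(U\circ\sigma)(z)-z$ are exactly the fixed points of $U\circ\sigma$. A logit equilibrium of $\mathcal{G}$ is a mixed strategy $\overline x^\star\in\Delta^{n-1}$ with $\overline x^\star=\sigma(U(\overline x^\star))$; equivalently, $\overline x^\star=\sigma(\overline z^\star)$ where $\overline z^\star=U(\overline x^\star)$. *)

(* Defs.v *)
From HB Require Import structures.
From mathcomp Require Import all_boot all_order all_algebra.
From mathcomp Require Import all_classical all_reals all_analysis.

Set Implicit Arguments.
Unset Strict Implicit.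
Unset Printing Implicit Defensive.

Import Order.TTheory GRing.Theory Num.Theory.
Import numFieldNormedType.Exports.

Local Open Scope classical_set_scope.
Local Open Scope ring_scope.

(* Vectors of R^n are row vectors 'rV[R]_n, and the action set {1, ..., n} is
   'I_n; 'rV[R]_n carries the max norm, which induces the usual topology. *)

Definition simplex (R : realType) (n : nat) : set 'rV[R]_n :=
  [set x | \sum_(i < n) x ord0 i = 1 /\ forall i, 0 <= x ord0 i].

Definition softmax (R : realType) (n : nat) (lam : R) (z : 'rV[R]_n) :
    'rV[R]_n :=
  \row_i (expR (lam * z ord0 i) / \sum_(j < n) expR (lam * z ord0 j)).

Definition dot (R : realType) (n : nat) (x y : 'rV[R]_n) : R :=
  \sum_(i < n) x ord0 i * y ord0 i.

(* A payoff map on the simplex is a total function U : 'rV_n -> 'rV_n of which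
   only the values on the simplex matter. *)

Definition anti_monotone (R : realType) (n : nat)
    (U : 'rV[R]_n -> 'rV[R]_n) : Prop :=
  forall x x', simplex x -> simplex x' -> dot (x - x') (U x - U x') <= 0.

Definition fixpoints (T : Type) (f : T -> T) : set T := [set z | f z = z].

Definition logit_equilibrium (R : realType) (n : nat) (lam : R)
    (U : 'rV[R]_n -> 'rV[R]_n) (x : 'rV[R]_n) : Prop :=
  simplex x /\ x = softmax lam (U x).

(* z solves dz/dt = F z on [0, +oo[, the derivative at 0 being one-sided;
   the values of z at negative times are irrelevant. *)
Definition solves_ode (R : realType) (n : nat)
    (F : 'rV[R]_n -> 'rV[R]_n) (z : R -> 'rV[R]_n) : Prop :=
  (forall t : R, 0 < t -> is_derive t 1 z (F (z t))) /\
  h^-1 *: (z h - z 0) @[h --> 0^'+] --> F (z 0).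

(* The score dynamics dz/dt = u - z with u = U x and x = softmax z. *)
Definition exd_rl_score (R : realType) (n : nat) (lam : R)
    (U : 'rV[R]_n -> 'rV[R]_n) (z : R -> 'rV[R]_n) : Prop :=
  solves_ode (fun w => U (softmax lam w) - w) z.

(* Main.v *)
Require Import Defs.
From HB Require Import structures.
From mathcomp Require Import all_boot all_order all_algebra.
From mathcomp Require Import all_classical all_reals all_analysis.
From mathcomp Require Import ring lra.
Import Order.TTheory GRing.Theory Num.Theory.
Import numFieldNormedType.Exports.
Local Open Scope classical_set_scope.
Local Open Scope ring_scope.

(** Write x(t) = softmax (z(t)) and KL(y, x) = sum_i y_i (ln y_i - ln x_i).
    For a score w of y, KL(y, x(t)) is the Bregman divergence from w to z(t)
    of the log-partition function, and its time derivative is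
    lam <x - y, U x - z>.  Since lam z = ln x + a constant vector, and
    constant vectors are orthogonal to differences of mixed strategies,
    anti-monotonicity of U gives, for every y with positive entries,

      d/dt KL(y, x(t)) <= <x - y, lam U y - ln y> - KL(y, x)

    ([kl_dissipation]).  The vector lam U y - ln y is the [defect] of y: its
    entries are all equal exactly when y is a logit equilibrium.

    Convergence.  If xs is a logit equilibrium, the inner product on the right
    vanishes for y = xs, so KL(xs, x(t)) is at most a multiple of exp (- t).
    The divergence dominates squared distances ([kl_ge_sqrB]), hence x(t) tends
    to xs.  Then U (x(t)) tends to U xs, and the score, which relaxes towards
    U (x(t)), has the same limit ([relaxation_cvg], [score_cvg]).

    Existence of an equilibrium.  It is extracted from the trajectory itself
    rather than from a fixed point theorem.  Integrating the inequality above
    and using KL >= 0, the time average m(t) of x satisfies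
    <m(t) - y, defect y> >= - C_y / t ([time_average_variational]).  The score
    is bounded, so x(t) and m(t) stay in a compact part of the open simplex,
    and a cluster point xs of m satisfies <xs - y, defect y> >= 0 for all y
    with positive entries.  Moving y towards xs along the edge directions of the
    simplex (Minty's argument, [minty_defect_le]) shows that the defect of xs is
    constant.

    All estimates start at time 1 instead of 0, so that every derivative in them
    is two-sided. *)

Set Implicit Arguments.
Unset Strict Implicit.

(** * Kullback-Leibler divergence on the open simplex *)

Section KullbackLeibler.
Context {R : realType}.

Lemma ln_le_subr1 (a : R) : 0 < a -> ln a <= a - 1.
Proof.
move=> a0; have := @le_ln1Dx R (a - 1).
by rewrite (_ : 1 + (a - 1) = a); [apply; rewrite ltrBrDr addNr|ring].
Qed.

(** With p and q the square roots of a and b, the bound ln (q / p) <= q / p - 1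
    turns the right-hand side into at least (p - q)^2, a Hellinger distance,
    and a - b = (p - q) (p + q) with p + q <= 2. *)
Lemma sqrB_le_entropy (a b : R) : 0 < a <= 1 -> 0 < b <= 1 ->
  (a - b) ^+ 2 / 4 <= a * (ln a - ln b) - a + b.
Proof.
move=> /andP[a0 a1] /andP[b0 b1].
pose p := Num.sqrt a; pose q := Num.sqrt b.
have p0 : 0 < p by rewrite sqrtr_gt0.
have q0 : 0 < q by rewrite sqrtr_gt0.
have p1 : p <= 1 by rewrite -[leRHS]sqrtr1 ler_wsqrtr.
have q1 : q <= 1 by rewrite -[leRHS]sqrtr1 ler_wsqrtr.
have aE : a = p ^+ 2 by rewrite sqr_sqrtr// ltW.
have bE : b = q ^+ 2 by rewrite sqr_sqrtr// ltW.
have lnE : ln a - ln b = - 2 * ln (q / p).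
  by rewrite aE bE !lnXn// ln_div ?posrE//; ring.
have entropy_ge : (p - q) ^+ 2 <= a * (ln a - ln b) - a + b.
  have lnqp : ln (q / p) <= q / p - 1 by rewrite ln_le_subr1// divr_gt0.
  have : p ^+ 2 * ln (q / p) <= p ^+ 2 * (q / p - 1).
    by rewrite ler_pM2l ?exprn_gt0.
  rewrite (_ : p ^+ 2 * (q / p - 1) = p * q - p ^+ 2); last first.
    by field; rewrite gt_eqF.
  rewrite lnE aE bE; nra.
apply: le_trans entropy_ge; rewrite aE bE.
have : (p + q) ^+ 2 <= 4 by nra.
have := sqr_ge0 (p - q); nra.
Qed.

Definition pos_simplex (n : nat) : set 'rV[R]_n :=
  [set x | simplex x /\ forall i, 0 < x ord0 i].

Lemma simplex_le1 (n : nat) (x : 'rV[R]_n) i : simplex x -> x ord0 i <= 1.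
Proof.
move=> [<- x0]; rewrite (bigD1 i)//= lerDl sumr_ge0//.
Qed.

Definition kl (n : nat) (y x : 'rV[R]_n) : R :=
  \sum_i y ord0 i * (ln (y ord0 i) - ln (x ord0 i)).

(** A weak form of Pinsker's inequality.  As y and x have the same mass, the
    terms - y_j + x_j can be added to the divergence for free, after which
    every summand is nonnegative and the i-th one suffices. *)
Lemma kl_ge_sqrB (n : nat) (y x : 'rV[R]_n) i :
  pos_simplex y -> pos_simplex x ->
  (y ord0 i - x ord0 i) ^+ 2 / 4 <= kl y x.
Proof.
move=> [sy y0] [sx x0].
have -> : kl y x = \sum_j (y ord0 j * (ln (y ord0 j) - ln (x ord0 j))
    - y ord0 j + x ord0 j).
  by rewrite big_split sumrB /= sy.1 sx.1 subrK.
have term_ge j := @sqrB_le_entropy (y ord0 j) (x ord0 j).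
have le01 (w : 'rV[R]_n) j : simplex w -> 0 < w ord0 j -> 0 < w ord0 j <= 1.
  by move=> sw wj; rewrite wj; exact: simplex_le1.
rewrite (bigD1 i)//= -[leLHS]addr0 lerD//; first by rewrite term_ge ?le01.
apply: sumr_ge0 => j _; apply: le_trans (term_ge j _ _); rewrite ?le01//.
by rewrite divr_ge0 ?sqr_ge0.
Qed.

Lemma kl_ge0 (n : nat) (y x : 'rV[R]_n) :
  pos_simplex y -> pos_simplex x -> 0 <= kl y x.
Proof.
case: n y x => [|n] y x py px; first by rewrite /kl big_ord0.
apply: le_trans (@kl_ge_sqrB _ _ _ ord0 py px).
by rewrite divr_ge0 ?sqr_ge0.
Qed.

End KullbackLeibler.

(** * The softmax function *)

Section Softmax.
Context {R : realType} {n : nat} (lam : R).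
Hypothesis hn : (1 <= n)%N.
Implicit Types z w x y : 'rV[R]_n.

Definition partition_fun z := \sum_(j < n) expR (lam * z ord0 j).

Lemma partition_fun_gt0 z : 0 < partition_fun z.
Proof.
rewrite /partition_fun (bigD1 (Ordinal hn))//= ltr_pwDl ?expR_gt0//.
by apply: sumr_ge0 => j _; exact: expR_ge0.
Qed.

Lemma softmax_pos_simplex z : pos_simplex (softmax lam z).
Proof.
have S0 := partition_fun_gt0 z.
have pos i : 0 < softmax lam z ord0 i by rewrite mxE divr_gt0 ?expR_gt0.
split=> //; split; last by move=> i; exact: ltW.
under eq_bigr do rewrite mxE.
by rewrite -mulr_suml divff// gt_eqF.
Qed.

(** The score is recovered from the strategy up to a constant vector,
    and differences of strategies are orthogonal to constant vectors. *)
Lemma ln_softmax z i :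
  ln (softmax lam z ord0 i) = lam * z ord0 i - ln (partition_fun z).
Proof.
by rewrite mxE ln_div ?posrE ?expR_gt0 ?partition_fun_gt0// expRK.
Qed.

Lemma softmax_ln x w c : pos_simplex x ->
  (forall i, lam * w ord0 i = ln (x ord0 i) + c) -> softmax lam w = x.
Proof.
move=> [[sx _] x0] wE; have expE i : expR (lam * w ord0 i) = x ord0 i * expR c.
  by rewrite wE expRD lnK ?posrE.
apply/rowP => i; rewrite mxE expE; under eq_bigr do rewrite expE.
by rewrite -mulr_suml sx mul1r mulfK// gt_eqF// expR_gt0.
Qed.

End Softmax.

(** * Differential inequalities of relaxation type *)

Section DifferentialInequalities.
Context {R : realType}.

Lemma is_derive_le0_nincr (f df : R -> R) (T : R) :
  (forall t, T <= t -> is_derive t 1 f (df t)) ->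
  (forall t, T <= t -> df t <= 0) -> forall t, T <= t -> f t <= f T.
Proof.
move=> fdf df0 t Tt; rewrite -subr_le0.
have [s| |s] := @MVT_segment R f df T t Tt.
- by rewrite in_itv/= => /andP[/ltW Ts _]; exact: fdf.
- apply: derivable_within_continuous => s; rewrite in_itv/= => /andP[Ts _].
  by have [] := fdf _ Ts.
- rewrite in_itv/= => /andP[Ts _] ->.
  by rewrite mulr_le0_ge0 ?df0 ?subr_ge0.
Qed.

(** Gronwall's lemma for f' <= M - f: expR t * (f t - M) is nonincreasing. *)
Lemma relaxation_le (f df : R -> R) (T M : R) :
  (forall t, T <= t -> is_derive t 1 f (df t)) ->
  (forall t, T <= t -> df t <= M - f t) ->
  forall t, T <= t -> f t <= M + (f T - M) * expR (T - t).
Proof.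
move=> fdf dfM t Tt.
pose g s := expR s * (f s - M).
have gdg s : T <= s -> is_derive s 1 g (expR s * (f s - M) + expR s * df s).
  move=> Ts; have := fdf _ Ts => fs.
  rewrite /g; apply: is_derive_eq.
  by rewrite /GRing.scale/= subr0; ring.
have dg0 s : T <= s -> expR s * (f s - M) + expR s * df s <= 0.
  move=> Ts; rewrite -mulrDr pmulr_rle0 ?expR_gt0//.
  by rewrite addrC -lerBrDr sub0r opprB dfM.
have := is_derive_le0_nincr gdg dg0 Tt.
rewrite /g expRB mulrA [(f T - M) * _]mulrC.
by rewrite -lerBlDl ler_pdivlMr ?expR_gt0// [(_ - _) * expR t]mulrC.
Qed.

(** A low-pass filter forgets its initial condition: once the input u is
    within e / 2 of l, [relaxation_le] applied to f and to - f leaves only an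
    exponentially small excess. *)
Lemma relaxation_cvg (f u : R -> R) (T l : R) :
  (forall t, T <= t -> is_derive t 1 f (u t - f t)) ->
  u t @[t --> +oo] --> l -> f t @[t --> +oo] --> l.
Proof.
move=> fu /cvgrPdist_le ul; apply/cvgrPdist_le => e e0.
have e20 : 0 < e / 2 by rewrite divr_gt0.
have [N [_ uN]] := ul _ e20.
pose T' := Num.max T (N + 1).
have TT' : T <= T' by rewrite le_max lexx.
have uT' t : T' <= t -> `|l - u t| <= e / 2.
  rewrite ge_max => /andP[_ Nt]; apply: uN.
  by apply: lt_le_trans Nt; rewrite ltrDl.
have upper t : T' <= t ->
    f t <= l + e / 2 + (f T' - (l + e / 2)) * expR (T' - t).
  apply: (@relaxation_le _ (fun s => u s - f s)) => s T's.
    by apply: fu; apply: le_trans T's.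
  by rewrite lerD2r; have := uT' _ T's; rewrite ler_norml => /andP[]; lra.
have lower t : T' <= t ->
    - f t <= - l + e / 2 + (- f T' - (- l + e / 2)) * expR (T' - t).
  apply: (@relaxation_le (- f) (fun s => - (u s - f s))) => s T's.
    by apply: is_deriveN; apply: fu; apply: le_trans T's.
  rewrite (_ : (- f) s = - f s)//.
  by have := uT' _ T's; rewrite ler_norml => /andP[]; lra.
have small c : \forall t \near +oo, c * expR (T' - t) <= e / 2.
  have : (c * expR T') * expR (- t) @[t --> +oo] --> (c * expR T') * 0.
    by apply: cvgMr; exact: cvgr_expR.
  rewrite mulr0 => /cvgrPdist_le/(_ _ e20); apply: filterS => t.
  by rewrite sub0r normrN expRD mulrA; apply: le_trans; exact: ler_norm.
near=> t.
have T't : T' <= t by near: t; apply: nbhs_pinfty_ge; exact: num_real.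
have s1 : (f T' - (l + e / 2)) * expR (T' - t) <= e / 2.
  by near: t; exact: small.
have s2 : (- f T' - (- l + e / 2)) * expR (T' - t) <= e / 2.
  by near: t; exact: small.
have := upper t T't; have := lower t T't; rewrite ler_norml => *.
by apply/andP; split; lra.
Unshelve. all: by end_near. Qed.

End DifferentialInequalities.

(** * Derivatives along a score trajectory *)

Section CoordinateDerivatives.
Context {R : realType} {n : nat}.

Lemma is_derive_coord (z : R -> 'rV[R]_n) (v : 'rV[R]_n) (t : R)
    (i : 'I_n) :
  is_derive t 1 z v -> is_derive t 1 (fun s => z s ord0 i) (v ord0 i).
Proof.
move=> [dz zv]; apply: DeriveDef; first by move/derivable_mxP : dz; exact.
by rewrite -zv derive_mx// mxE.
Qed.

End CoordinateDerivatives.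

Section SoftmaxDerivatives.
Context {R : realType} {n : nat} (lam : R) (hn : (1 <= n)%N).

Lemma is_derive_ln_partition_fun (z : R -> 'rV[R]_n) (v : 'rV[R]_n) (t : R) :
  is_derive t 1 z v ->
  is_derive t 1 (fun s => ln (partition_fun lam (z s)))
    (lam * dot (softmax lam (z t)) v).
Proof.
move=> zv; have S0 := partition_fun_gt0 lam hn (z t).
have dS : is_derive t 1 (fun s => partition_fun lam (z s))
    (\sum_i expR (lam * z t ord0 i) * (lam * v ord0 i)).
  pose h (i : 'I_n) s := expR (lam * z s ord0 i).
  have -> : (fun s => partition_fun lam (z s)) = \sum_i h i.
    by apply/funext => s; rewrite fct_sumE.
  apply: is_derive_sum => i.
  have zvi := is_derive_coord i zv.
  by apply: is_derive_eq; rewrite /GRing.scale/=; ring.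
have dln := is_derive1_ln S0.
apply: is_derive_eq; rewrite /GRing.scale/= /dot !mulr_sumr.
apply: eq_bigr => i _; rewrite mxE -/(partition_fun lam (z t)); ring.
Qed.

(** By [ln_softmax] the divergence is the log-partition function minus a linear
    function of the score, and the gradient of the former is lam times the
    softmax. *)
Lemma is_derive_kl_softmax (z : R -> 'rV[R]_n) (v y : 'rV[R]_n) (t : R) :
  \sum_i y ord0 i = 1 -> is_derive t 1 z v ->
  is_derive t 1 (fun s => kl y (softmax lam (z s)))
    (lam * dot (softmax lam (z t) - y) v).
Proof.
move=> sy zv.
have -> : (fun s => kl y (softmax lam (z s))) = (fun s =>
    \sum_i y ord0 i * ln (y ord0 i) +
    (ln (partition_fun lam (z s)) - \sum_i y ord0 i * (lam * z s ord0 i))).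
  apply/funext => s; rewrite /kl.
  under eq_bigr do rewrite ln_softmax// mulrBr mulrBr opprB addrCA.
  by rewrite big_split -mulr_suml sy mul1r /= sumrB; ring.
have dlin : is_derive t 1 (fun s => \sum_i y ord0 i * (lam * z s ord0 i))
    (\sum_i y ord0 i * (lam * v ord0 i)).
  pose h (i : 'I_n) s := y ord0 i * (lam * z s ord0 i).
  have -> : (fun s => \sum_i y ord0 i * (lam * z s ord0 i)) = \sum_i h i.
    by apply/funext => s; rewrite fct_sumE.
  apply: is_derive_sum => i.
  have zvi := is_derive_coord i zv.
  by apply: is_derive_eq; rewrite /GRing.scale/=; ring.
have dln := is_derive_ln_partition_fun zv.
apply: is_derive_eq.
rewrite add0r /dot !mulr_sumr -sumrB mul1r; apply: eq_bigr => i _.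
by rewrite !mxE/=; ring.
Qed.

Lemma continuous_softmax_path (z : R -> 'rV[R]_n) (v : 'rV[R]_n) (t : R)
    (i : 'I_n) :
  is_derive t 1 z v -> {for t, continuous (fun s => softmax lam (z s) ord0 i)}.
Proof.
move=> zv.
have -> : (fun s => softmax lam (z s) ord0 i) =
    (fun s => expR (lam * z s ord0 i - ln (partition_fun lam (z s)))).
  apply/funext => s; rewrite -ln_softmax// lnK// posrE.
  exact: (softmax_pos_simplex lam hn (z s)).2.
apply/differentiable_continuous/derivable1_diffP.
have zvi := is_derive_coord i zv; have dln := is_derive_ln_partition_fun zv.
by apply: ex_derive.
Qed.

End SoftmaxDerivatives.

(** * Topology of the simplex and antiderivatives *)

Section RowVectorTopology.
Context {R : realType} {n : nat}.
Implicit Types x l : 'rV[R]_n.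

Lemma coord_le_norm x i : `|x ord0 i| <= `|x|.
Proof.
rewrite [leRHS]/Num.Def.normr/= mx_normrE.
exact: (le_bigmax _ (fun k : 'I_1 * 'I_n => `|x k.1 k.2|) (ord0, i)).
Qed.

Lemma cvg_coordP {T : Type} (F : set_system T) {FF : Filter F}
    (f : T -> 'rV[R]_n) l :
  f t @[t --> F] --> l <->
  forall i, f t ord0 i @[t --> F] --> l ord0 i.
Proof.
split=> [fl i|fl].
  apply: (cvg_comp f (fun x : 'rV[R]_n => x ord0 i) fl).
  exact: coord_continuous.
apply/cvgrPdist_le => e e0; near=> t.
rewrite /Num.Def.normr/= mx_normrE (bigmax_le _ (ltW e0))//= => -[k i] _ /=.
rewrite !ord1 !mxE; move: i; near: t; apply: filter_forall => i.
by have /cvgrPdist_le := fl i; exact.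
Unshelve. all: by end_near. Qed.

(** For d = 0 this is the simplex itself; for d > 0 it is a part of the open
    simplex that time averages of the strategy do not leave. *)
Lemma compact_simplex_ge (d : R) : 0 <= d ->
  compact [set x : 'rV[R]_n | simplex x /\ forall i, d <= x ord0 i].
Proof.
move=> d0.
have closedE : closed [set x : 'rV[R]_n | \sum_i x ord0 i = 1].
  have sc : continuous (fun x : 'rV[R]_n => \sum_i x ord0 i).
    apply: continuous_big => [|i _]; first exact: add_continuous.
    exact: coord_continuous.
  by have /continuous_closedP/(_ _ (@closed_eq R 1)) := sc.
have cbox : compact [set x : 'rV[R]_n | forall i, `[d, 1]%classic (x ord0 i)].
  apply: (@rV_compact _ _ (fun=> `[d, 1]%classic)) => _.
  exact: segment_compact.
rewrite (_ : mkset _ = [set x : 'rV[R]_n | forall i, `[d, 1]%classic (x ord0 i)]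
   `&` [set x : 'rV[R]_n | \sum_i x ord0 i = 1]).
  by apply: compact_closedI.
apply/seteqP; split=> [x [sx dx]|x [bx sx]] /=.
  by split; [move=> i; rewrite /= in_itv/= dx simplex_le1|exact: sx.1].
have dx i : d <= x ord0 i by have := bx i; rewrite /= in_itv/= => /andP[].
by split=> //; split=> // i; exact: le_trans (dx i).
Qed.

Lemma bounded_on_simplex (U : 'rV[R]_n -> 'rV[R]_n) :
  {within @simplex R n, continuous U} ->
  exists M, forall x i, simplex x -> `|U x ord0 i| <= M.
Proof.
move=> Uc; have sE : @simplex R n =
    [set x : 'rV[R]_n | simplex x /\ forall i, 0 <= x ord0 i].
  by apply/seteqP; split=> x; [move=> sx; split=> //; exact: sx.2|case].
have cs : compact (@simplex R n) by rewrite sE; exact: compact_simplex_ge.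
have [N [_ UN]] := compact_bounded (continuous_compact Uc cs).
exists (N + 1) => x i sx; apply: (le_trans (coord_le_norm _ _)).
by apply: UN; [rewrite ltrDl|exists x].
Qed.

Lemma cvg_on_simplex {T : Type} (F : set_system T) {FF : Filter F}
    (U : 'rV[R]_n -> 'rV[R]_n) (f : T -> 'rV[R]_n) l :
  {within @simplex R n, continuous U} -> simplex l ->
  (\forall t \near F, simplex (f t)) -> f t @[t --> F] --> l ->
  U (f t) @[t --> F] --> U l.
Proof.
move=> /subspace_continuousP Uc sl sf fl.
apply: cvg_trans (Uc l sl) => A UA.
have fA := fl _ UA.
have {}fA : \forall t \near F, simplex (f t) -> A (U (f t)) := fA.
rewrite /nbhs/= -[F _]/(\forall t \near F, A (U (f t))).
by move: fA sf; apply: filterS2 => t; exact.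
Qed.

End RowVectorTopology.

(** The integral starts at a, strictly before b, so that the derivative at b is
    two-sided. *)
Lemma continuous_antiderivative {R : realType} (f : R -> R) (a b : R) :
  a < b -> (forall t, a <= t -> {for t, continuous f}) ->
  exists F, forall t, b <= t -> is_derive t 1 F (f t).
Proof.
move=> ab fc; exists (fun t => (\int[lebesgue_measure]_(s in `[a, t]) f s)%R).
move=> t bt; have a_t : a < t by exact: lt_le_trans bt.
have int_f : lebesgue_measure.-integrable `[a, t + 1] (EFin \o f).
  apply: continuous_compact_integrable; first exact: segment_compact.
  apply: continuous_in_subspaceT => s; rewrite inE/= in_itv/= => /andP[as_ _].
  exact: fc.
have t_t1 : t < t + 1 by rewrite ltrDl.
have [dF F'E] := continuous_FTC1_closed t_t1 int_f a_t (fc t (ltW a_t)).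
by apply: DeriveDef dF _; rewrite -derive1E.
Qed.

(** * Logit equilibria and the dissipation inequality *)

Section Equilibria.
Context {R : realType} {n : nat} (lam : R) (hn : (1 <= n)%N) (lam0 : 0 < lam).
Context (U : 'rV[R]_n -> 'rV[R]_n).
Implicit Types x y w : 'rV[R]_n.

(** The defect lam U(y) - ln y of a strategy y with positive entries is a
    constant vector exactly when y = softmax (U y). *)
Definition defect y : 'rV[R]_n := \row_i (lam * U y ord0 i - ln (y ord0 i)).

Lemma softmax_defect_const x :
  pos_simplex x -> (forall i j, defect x ord0 i <= defect x ord0 j) ->
  softmax lam (U x) = x.
Proof.
move=> px dle.
apply: (@softmax_ln _ _ _ _ _ (defect x ord0 (Ordinal hn))) => // i.
have -> : defect x ord0 (Ordinal hn) = defect x ord0 i.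
  by apply/eqP; rewrite eq_le !dle.
by rewrite !mxE addrC subrK.
Qed.

Lemma dot_const x y w : simplex x -> simplex y ->
  (forall i j, w ord0 i = w ord0 j) -> dot (x - y) w = 0.
Proof.
move=> [sx _] [sy _] wE.
transitivity (\sum_i (x ord0 i - y ord0 i) * w ord0 (Ordinal hn)).
  by apply: eq_bigr => i _; rewrite !mxE (wE i (Ordinal hn)).
by rewrite -mulr_suml sumrB sx sy subrr mul0r.
Qed.

(** The central inequality; its left-hand side is the derivative of KL(y, x(t))
    at score w.  Replacing U x by U y costs lam <x - y, U x - U y> <= 0, and
    replacing lam w = ln x + const by ln y costs <x - y, ln x - ln y>, which is
    KL(x, y) + KL(y, x); only the second divergence is kept. *)
Lemma kl_dissipation y w : anti_monotone U -> pos_simplex y ->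
  lam * dot (softmax lam w - y) (U (softmax lam w) - w) <=
  dot (softmax lam w - y) (defect y) - kl y (softmax lam w).
Proof.
move=> mU py; set x := softmax lam w.
have px : pos_simplex x by exact: softmax_pos_simplex.
have mono : lam * dot (x - y) (U x - U y) <= 0.
  by rewrite pmulr_rle0// mU //; [exact: px.1|exact: py.1].
have klxy : 0 <= kl x y by exact: kl_ge0.
have const : dot (x - y) (const_mx (ln (partition_fun lam w))) = 0.
  by apply: dot_const; [exact: px.1|exact: py.1|move=> i j; rewrite !mxE].
have -> : lam * dot (x - y) (U x - w) = lam * dot (x - y) (U x - U y)
    + dot (x - y) (defect y) - kl y x - kl x y
    - dot (x - y) (const_mx (ln (partition_fun lam w))).
  rewrite /dot /kl !mulr_sumr -!big_split -!sumrB /=; apply: eq_bigr => i _.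
  have lnx := ln_softmax lam hn w i; rewrite -/x in lnx.
  have wE : w ord0 i = (ln (x ord0 i) + ln (partition_fun lam w)) / lam.
    by rewrite lnx subrK mulrAC divff ?mul1r// gt_eqF.
  move: wE; move: (x) => x'; rewrite !mxE => ->.
  by field; rewrite gt_eqF.
rewrite const; lra.
Qed.

Lemma sum_delta (f : 'I_n -> R) i : \sum_k (k == i)%:R * f k = f i.
Proof.
rewrite (bigD1 i)//= eqxx mul1r big1 ?addr0// => k /negPf ->.
by rewrite mul0r.
Qed.

(** Minty's argument: testing the hypothesis at y = x + e v, with
    v = delta_i - delta_j, and dividing by e > 0 compares the i-th and j-th
    defects at y; continuity of U and ln carries the comparison to e = 0. *)
Lemma minty_defect_le x :
  {within @simplex R n, continuous U} -> pos_simplex x ->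
  (forall y, pos_simplex y -> 0 <= dot (x - y) (defect y)) ->
  forall i j, defect x ord0 i <= defect x ord0 j.
Proof.
move=> Uc px var i j.
pose v : 'rV[R]_n := \row_k ((k == i)%:R - (k == j)%:R).
pose y e := x + e *: v.
have yE e k : y e ord0 k = x ord0 k + e * ((k == i)%:R - (k == j)%:R).
  by rewrite !mxE.
have ye k : y e ord0 k @[e --> 0^'+] --> x ord0 k.
  under eq_cvg do rewrite yE.
  set c := _ - _; have : x ord0 k + e * c @[e --> 0^'+] --> x ord0 k + 0 * c.
    apply: cvgD; first exact: cvg_cst.
    by apply: cvgMl; apply: cvg_at_right_filter; exact: cvg_id.
  by rewrite mul0r addr0.
have py : \forall e \near 0^'+, pos_simplex (y e).
  have pos : \forall e \near 0^'+, forall k, 0 < y e ord0 k.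
    by apply: filter_forall => k; apply: (cvgr_gt _ (ye k)); exact: px.2.
  apply: filterS pos => e pos; split=> //; split; last by move=> k; exact: ltW.
  under eq_bigr do rewrite yE mulrBr.
  rewrite big_split sumrB /= px.1.1.
  under eq_bigr do rewrite mulrC.
  under [X in _ + (_ - X)]eq_bigr do rewrite mulrC.
  by rewrite !(sum_delta (fun=> e)) subrr addr0.
have cU : U (y e) @[e --> 0^'+] --> U x.
  apply: cvg_on_simplex => //; first exact: px.1.
  - by apply: filterS py => e [].
  - exact/cvg_coordP.
have cdefect k : defect (y e) ord0 k @[e --> 0^'+] --> defect x ord0 k.
  under eq_cvg do rewrite mxE.
  rewrite mxE; apply: cvgB.
    by apply: cvgMr; move/cvg_coordP : cU; exact.
  apply: (cvg_comp (fun e => y e ord0 k) (@ln R) (ye k)).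
  by apply: continuous_ln; exact: px.2.
apply: ler_cvg_to (cdefect i) (cdefect j) _.
near=> e.
have e0 : 0 < e by near: e; exact: nbhs_right_gt.
have /var : pos_simplex (y e) by near: e.
have -> : dot (x - y e) (defect (y e)) =
    e * (defect (y e) ord0 j - defect (y e) ord0 i).
  rewrite -(sum_delta (fun k => defect (y e) ord0 k) i).
  rewrite -(sum_delta (fun k => defect (y e) ord0 k) j).
  rewrite -sumrB mulr_sumr; apply: eq_bigr => k _.
  have -> : (x - y e) ord0 k = - (e * ((k == i)%:R - (k == j)%:R)).
    by rewrite !mxE; ring.
  by ring.
by rewrite pmulr_rge0// subr_ge0.
Unshelve. all: by end_near. Qed.

(** Bounded scores keep the strategy away from the boundary of the simplex. *)
Lemma softmax_ge (B : R) w i : (forall j, `|w ord0 j| <= B) ->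
  expR (- (lam * B)) / (n%:R * expR (lam * B)) <= softmax lam w ord0 i.
Proof.
move=> wB.
have low j : - (lam * B) <= lam * w ord0 j <= lam * B.
  by have := wB j; rewrite -mulrN !ler_pM2l// -ler_norml.
have S0 := partition_fun_gt0 lam hn w.
rewrite mxE ler_pdivrMr ?mulr_gt0 ?expR_gt0 ?ltr0n// -/(partition_fun lam w).
rewrite mulrAC ler_pdivlMr// ler_pM ?expR_ge0 ?ler_expR//; first exact: ltW.
  by case/andP : (low i).
have -> : n%:R * expR (lam * B) = \sum_(j < n) expR (lam * B).
  by rewrite sumr_const card_ord mulr_natl.
by apply: ler_sum => j _; rewrite ler_expR; case/andP : (low j).
Qed.

End Equilibria.

(** * Asymptotics of the score dynamics *)

Section Trajectories.
Context {R : realType} {n : nat} (lam : R) (hn : (1 <= n)%N) (lam0 : 0 < lam).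
Context (U : 'rV[R]_n -> 'rV[R]_n) (z : R -> 'rV[R]_n).
Hypothesis Ucont : {within @simplex R n, continuous U}.
Hypothesis Uanti : anti_monotone U.
Hypothesis zode : forall t : R, 0 < t ->
  is_derive t 1 z (U (softmax lam (z t)) - z t).

Local Notation x t := (softmax lam (z t)).

Let zode1 (t : R) : 1 <= t -> is_derive t 1 z (U (x t) - z t).
Proof. by move=> t1; apply: zode; exact: lt_le_trans t1. Qed.

Let xpos t : pos_simplex (x t).
Proof. exact: softmax_pos_simplex. Qed.

Let score_derive (t : R) i : 1 <= t ->
  is_derive t 1 (fun s => z s ord0 i) (U (x t) ord0 i - z t ord0 i).
Proof.
by move=> t1; have := is_derive_coord i (zode1 t1); rewrite !mxE.
Qed.

Lemma score_bounded : exists B, forall (t : R) i, 1 <= t -> `|z t ord0 i| <= B.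
Proof.
have [M UM] := bounded_on_simplex Ucont.
exists (M + (`|z 1| + `|M|)) => t i t1.
have UMt s : `|U (x s) ord0 i| <= M by apply: UM; exact: (xpos s).1.
have decay (c : R) : `|c| <= `|z 1| ->
    M + (c - M) * expR (1 - t) <= M + (`|z 1| + `|M|).
  move=> cz; rewrite lerD2l; apply: le_trans (ler_norm _) _; rewrite normrM.
  apply: (@le_trans _ _ (`|c - M| * 1)).
    rewrite ler_wpM2l// gtr0_norm ?expR_gt0//.
    by rewrite -[leRHS]expR0 ler_expR subr_le0.
  by rewrite mulr1; apply: le_trans (ler_normB _ _) _; rewrite lerD2r.
have z1i : `|z 1 ord0 i| <= `|z 1| by exact: coord_le_norm.
rewrite ler_norml lerNl; apply/andP; split.
  have zN1i : `|- z 1 ord0 i| <= `|z 1| by rewrite normrN.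
  apply: (le_trans _ (decay _ zN1i)).
  apply: (@relaxation_le _ (fun s => - z s ord0 i)
    (fun s => - (U (x s) ord0 i - z s ord0 i)) 1 M _ _ t t1) => s s1.
    by apply: is_deriveN; exact: score_derive.
  by have := UMt s; rewrite ler_norml => /andP[]; lra.
apply: (le_trans _ (decay _ z1i)).
apply: (@relaxation_le _ (fun s => z s ord0 i)
  (fun s => (U (x s) ord0 i - z s ord0 i)) 1 M _ _ t t1) => s s1.
  exact: score_derive.
by rewrite lerD2r; have := UMt s; rewrite ler_norml => /andP[].
Qed.

Lemma strategy_ge : exists2 d, 0 < d &
  forall (t : R) i, 1 <= t -> d <= x t ord0 i.
Proof.
have [B zB] := score_bounded.
exists (expR (- (lam * B)) / (n%:R * expR (lam * B))).
  by rewrite divr_gt0 ?mulr_gt0 ?expR_gt0 ?ltr0n.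
by move=> t i t1; apply: softmax_ge => // j; exact: zB.
Qed.

(** The initial value x(1) at t = 1, rather than 0, makes A(t) / t a point of
    the simplex for all t >= 1. *)
Lemma strategy_antiderivative : exists2 A : R -> 'rV[R]_n, A 1 = x 1 &
  forall (t : R) i, 1 <= t ->
    is_derive t 1 (fun s => A s ord0 i) (x t ord0 i).
Proof.
(* Any base point in ]0, 1[ would do: the path is differentiable there. *)
have half1 : 2^-1 < 1 :> R by rewrite invf_lt1// ltr1n.
have /choice[F dF] : forall i, exists F : R -> R,
    forall t : R, 1 <= t -> is_derive t 1 F (x t ord0 i).
  move=> i; apply: (continuous_antiderivative half1) => t t2.
  apply: continuous_softmax_path => //; apply: zode.
  by apply: lt_le_trans t2; rewrite invr_gt0.
exists (fun t => \row_i (F i t - F i 1 + x 1 ord0 i)).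
  by apply/rowP => i; rewrite mxE subrr add0r.
move=> t i t1; have dFi := dF i t t1.
rewrite (_ : (fun _ => _) = fun s => F i s - F i 1 + x 1 ord0 i); last first.
  by apply/funext => s; rewrite mxE.
by apply: is_derive_eq; rewrite addr0 subr0.
Qed.

Section TimeAverage.
Variable A : R -> 'rV[R]_n.
Hypothesis A1 : A 1 = x 1.
Hypothesis dA : forall (t : R) i, 1 <= t ->
  is_derive t 1 (fun s => A s ord0 i) (x t ord0 i).

Let is_derive_sumA (c y : 'I_n -> R) (t : R) : 1 <= t ->
  is_derive t 1 (fun s => \sum_i (A s ord0 i - s * y i) * c i)
    (\sum_i (x t ord0 i - y i) * c i).
Proof.
move=> t1; pose h (i : 'I_n) s := (A s ord0 i - s * y i) * c i.
have -> : (fun s => \sum_i (A s ord0 i - s * y i) * c i) = \sum_i h i.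
  by apply/funext => s; rewrite fct_sumE.
apply: is_derive_sum => i; have dAi := dA i t1.
by apply: is_derive_eq; rewrite /GRing.scale/=; ring.
Qed.

Lemma time_average_ge (d : R) : (forall (t : R) i, 1 <= t -> d <= x t ord0 i) ->
  forall (t : R) i, 1 <= t -> d <= (t^-1 *: A t) ord0 i.
Proof.
move=> xd t i t1; have t0 : 0 < t by exact: lt_le_trans t1.
rewrite mxE ler_pdivlMl// -subr_le0.
have nincr : forall s : R, 1 <= s -> s * d - A s ord0 i <= 1 * d - A 1 ord0 i.
  apply: (@is_derive_le0_nincr _ _ (fun s => d - x s ord0 i)) => s s1.
    have dAi := dA i s1.
    by apply: is_derive_eq; rewrite /GRing.scale/=; ring.
  by rewrite subr_le0 xd.
by apply: le_trans (nincr t t1) _; rewrite A1 mul1r subr_le0 xd.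
Qed.

Lemma time_average_simplex (t : R) : 1 <= t -> simplex (t^-1 *: A t).
Proof.
move=> t1; have t0 : 0 < t by exact: lt_le_trans t1.
split; last first.
  by move=> i; apply: (time_average_ge _ i t1) => s j _; exact: (xpos s).1.2.
under eq_bigr do rewrite mxE; rewrite -mulr_sumr.
suff -> : \sum_i A t ord0 i = t by rewrite mulVf// gt_eqF.
(* The sum of the entries of A - t / n has derivative 0; the signs c = 1 and
   c = - 1 give the two inequalities. *)
have sumA_le (c : R) : \sum_i (A t ord0 i - t * n%:R^-1) * c <=
    \sum_i (A 1 ord0 i - 1 * n%:R^-1) * c.
  apply: (is_derive_le0_nincr (is_derive_sumA (fun=> c) (fun=> n%:R^-1)) _ t1).
  move=> s _; rewrite -mulr_suml sumrB (xpos s).1.1 sumr_const card_ord.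
  by rewrite -[_ *+ n]mulr_natr mulVf ?subrr ?mul0r// pnatr_eq0 -lt0n.
have sumE (s c : R) : \sum_i (A s ord0 i - s * n%:R^-1) * c =
    (\sum_i A s ord0 i - s) * c.
  rewrite -mulr_suml sumrB sumr_const card_ord -[_ *+ n]mulr_natr mulfVK//.
  by rewrite pnatr_eq0 -lt0n.
have := sumA_le 1; have := sumA_le (-1); rewrite !sumE A1 (xpos 1).1.1; lra.
Qed.

(** KL(y, x(t)) - <A(t) - t y, defect y> is nonincreasing by [kl_dissipation],
    and KL >= 0. *)
Lemma time_average_variational y : pos_simplex y ->
  exists C, forall t : R, 1 <= t ->
    - (C / t) <= dot (t^-1 *: A t - y) (defect lam U y).
Proof.
move=> py.
pose g s := \sum_i (A s ord0 i - s * y ord0 i) * defect lam U y ord0 i.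
have dg (s : R) : 1 <= s -> is_derive s 1 g (dot (x s - y) (defect lam U y)).
  move=> s1; rewrite (_ : dot _ _ = \sum_i (x s ord0 i - y ord0 i) *
      defect lam U y ord0 i); last by apply: eq_bigr => i _; rewrite !mxE.
  exact: is_derive_sumA.
exists (kl y (x 1) - g 1) => t t1; have t0 : 0 < t by exact: lt_le_trans t1.
have nincr : kl y (x t) - g t <= kl y (x 1) - g 1.
  apply: (@is_derive_le0_nincr _ (fun s => kl y (x s) - g s)
    (fun s => lam * dot (x s - y) (U (x s) - z s) -
      dot (x s - y) (defect lam U y)) 1 _ _ t t1) => s s1.
    have dkl := is_derive_kl_softmax lam hn py.1.1 (zode1 s1).
    have dgs := dg s s1.
    exact: is_derive_eq.
  have := kl_dissipation hn lam0 (z s) Uanti py; have := kl_ge0 py (xpos s).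
  lra.
have -> : dot (t^-1 *: A t - y) (defect lam U y) = g t / t.
  rewrite /dot /g mulr_suml; apply: eq_bigr => i _.
  by rewrite [defect]lock !mxE; field; rewrite gt_eqF.
rewrite -mulNr ler_pM2r ?invr_gt0// opprB lerBlDr.
by have := kl_ge0 py (xpos t); lra.
Qed.

End TimeAverage.

(** A cluster point of the time averages inherits the limit of
    [time_average_variational], to which Minty's argument applies. *)
Lemma exists_logit_equilibrium : exists2 xs, pos_simplex xs &
  forall i j, defect lam U xs ord0 i <= defect lam U xs ord0 j.
Proof.
have [d d0 xd] := strategy_ge; have [A A1 dA] := strategy_antiderivative.
pose m t := t^-1 *: A t.
have ge1 : \forall t \near +oo, 1 <= t :> R.
  by apply: nbhs_pinfty_ge; exact: num_real.
have [] := @compact_simplex_ge R n d (ltW d0) (m t @[t --> +oo]).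
  apply: filterS ge1 => t t1; split; first exact: time_average_simplex.
  by move=> i; exact: time_average_ge.
move=> xs [[sxs dxs] clm].
have pxs : pos_simplex xs by split=> // i; exact: lt_le_trans (dxs i).
exists xs => //; apply: minty_defect_le => // y py.
have [C varC] := time_average_variational dA py.
pose l w := dot (w - y) (defect lam U y).
have lc : continuous l.
  rewrite (_ : l = fun w => \sum_i (w ord0 i - y ord0 i) *
      defect lam U y ord0 i); last first.
    by apply/funext => w; apply: eq_bigr => i _; rewrite !mxE.
  apply: continuous_big => [|i _ w]; first exact: add_continuous.
  rewrite /continuous_at.
  have wc : w' ord0 i - y ord0 i @[w' --> w] --> w ord0 i - y ord0 i.
    by apply: cvgB; [exact: coord_continuous|exact: cvg_cst].
  exact: cvgMl wc.
rewrite -/(l xs); apply/ler_addgt0Pl => e e0; rewrite -lerBlDl sub0r.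
have closedl : closed [set w | - e <= l w].
  by have /continuous_closedP/(_ _ (@closed_ge R (- e))) := lc.
rewrite -/([set w | - e <= l w] xs).
move/closure_id : closedl => ->.
have lm : \forall t \near +oo, - e <= l (m t).
  near=> t; have t1 : 1 <= t by near: t.
  have Ct : e^-1 * C <= t by near: t; apply: nbhs_pinfty_ge; exact: num_real.
  have t0 : 0 < t by exact: lt_le_trans t1.
  apply: le_trans (varC t t1).
  by rewrite lerN2 ler_pdivrMr// -ler_pdivrMl.
by move: clm; rewrite clusterE; apply; exact: lm.
Unshelve. all: by end_near. Qed.

(** At a logit equilibrium [kl_dissipation] reads KL' <= - KL. *)
Lemma score_cvg xs : pos_simplex xs ->
  (forall i j, defect lam U xs ord0 i <= defect lam U xs ord0 j) ->
  x t @[t --> +oo] --> xs /\ z t @[t --> +oo] --> U xs.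
Proof.
move=> pxs dxs.
have ge1 : \forall t \near +oo, 1 <= t :> R.
  by apply: nbhs_pinfty_ge; exact: num_real.
have klle t : 1 <= t -> kl xs (x t) <= kl xs (x 1) * expR (1 - t).
  move=> t1; have := @relaxation_le _ (fun s => kl xs (x s))
    (fun s => lam * dot (x s - xs) (U (x s) - z s)) 1 0 _ _ t t1.
  rewrite add0r subr0; apply=> s s1.
    exact: is_derive_kl_softmax pxs.1.1 (zode1 s1).
  apply: (le_trans (kl_dissipation hn lam0 _ Uanti pxs)).
  rewrite dot_const//; [exact: (xpos s).1|exact: pxs.1|move=> i j].
  by apply/eqP; rewrite eq_le !dxs.
have xcvg : x t @[t --> +oo] --> xs.
  apply/cvg_coordP => i; apply/cvgrPdist_le => e e0.
  have e24 : 0 < e ^+ 2 / 4 by rewrite divr_gt0 ?exprn_gt0.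
  have kl0 : kl xs (x 1) * expR (1 - t) @[t --> +oo] --> 0.
    under eq_cvg do rewrite expRD mulrA.
    have : kl xs (x 1) * expR 1 * expR (- t) @[t --> +oo] -->
        kl xs (x 1) * expR 1 * 0 by apply: cvgMr; exact: cvgr_expR.
    by rewrite mulr0.
  near=> t; have t1 : 1 <= t by near: t.
  have := le_trans (kl_ge_sqrB i pxs (xpos t)) (klle t t1).
  have : kl xs (x 1) * expR (1 - t) <= e ^+ 2 / 4.
    by near: t; exact: (cvgr_le 0 kl0).
  move=> /[swap] /le_trans /[apply].
  rewrite ler_pM2r// => sqr_le.
  by rewrite -ler_sqr ?nnegrE ?normr_ge0 ?(ltW e0)// real_normK// num_real.
split=> //; apply/cvg_coordP => i.
apply: (@relaxation_cvg _ _ (fun t => U (x t) ord0 i) 1).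
  by move=> t t1; exact: score_derive.
have Ucvg : U (x t) @[t --> +oo] --> U xs.
  apply: cvg_on_simplex => //; first exact: pxs.1.
  by near=> t; exact: (xpos t).1.
by move/cvg_coordP : Ucvg; exact.
Unshelve. all: by end_near. Qed.

End Trajectories.

Unset Implicit Arguments.

Theorem theorem2 (R : realType) (n : nat) (hn : (1 <= n)%N)
    (lam : R) (hlam : 0 < lam)
    (U : 'rV[R]_n -> 'rV[R]_n)
    (hUcont : {within @simplex R n, continuous U})
    (z : R -> 'rV[R]_n) (hz : exd_rl_score lam U z)
    (hfin : finite_set (fixpoints (U \o softmax lam)))
    (hiso : fixpoints (U \o softmax lam) `<=`
            isolated (fixpoints (U \o softmax lam)))
    (hmono : anti_monotone U) :
  exists zs : 'rV[R]_n,
    [/\ fixpoints (U \o softmax lam) zs,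
        z t @[t --> +oo] --> zs,
        softmax lam (z t) @[t --> +oo] --> softmax lam zs &
        logit_equilibrium lam U (softmax lam zs)].
Proof.
have [xs pxs dxs] := exists_logit_equilibrium hn hlam hUcont hmono hz.1.
have xsE : softmax lam (U xs) = xs by exact: softmax_defect_const pxs dxs.
have [xcvg zcvg] := score_cvg hn hlam hUcont hmono hz.1 pxs dxs.
exists (U xs); split; rewrite ?xsE//.
- by rewrite /fixpoints/= xsE.
- by split; [exact: pxs.1|rewrite xsE].
Qed.
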